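(* Let $\Lambda$ be a row-finite $k$-graph with no sources. (i) For any maximal tail $M$ of $\Lambda$, the set $\mathcal F(M):=\{x\in T_\Lambda : x\ge v(\mathbf n)\text{ for some }v\in M\text{ and }\mathbf n\in\mathbb Z^k\}$ is a prime $\mathbb Z^k$-filter of $T_\Lambda$. Moreover, $\mathcal F(M)=T_\Lambda\setminus J_{\Lambda^0\setminus M}$. (ii) For any prime $\mathbb Z^k$-filter $\mathcal F$ of $T_\Lambda$, the set $M(\mathcal F):=\{v\in\Lambda^0: v(0)\in\mathcal F\}$ is a maximal tail in $\Lambda$. Moreover, $M(\mathcal F)=\Lambda^0\setminus H_{T_\Lambda\setminus\mathcal F}$. (iii) The map $\varrho:\mathscr M(\Lambda)\to\mathscr{PF}il(T_\Lambda)$, $M\mapsto\mathcal F(M)$, is an order isomorphism with inverse $\vartheta:\mathscr{PF}il(T_\Lambda)\to\mathscr M(\Lambda)$, $\mathcal F\mapsto M(\mathcal F)$. Consequently, $M$ (a subset of $\Lambda^0$) is a maximal tail if and only if $\mathcal F(M)$ (defined by the same formula) is a prime $\mathbb Z^k$-filter of $T_\Lambda$.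
   Context: $k\ge1$ is an integer, $\mathbb N\ni0$, $\mathbf e_1,\dots,\mathbf e_k$ are the standard generators of $\mathbb N^k$. A $k$-graph is a countable small category $\Lambda$ with a functor $d:\Lambda\to\mathbb N^k$ such that whenever $d(\lambda)=\mathbf m+\mathbf n$ there are unique $\alpha,\beta$ with $d(\alpha)=\mathbf m$, $d(\beta)=\mathbf n$, $\lambda=\alpha\beta$. Objects are identified with $\Lambda^0=d^{-1}(0)$; $r(\lambda),s(\lambda)$ are the codomain and domain of $\lambda$; $v\Lambda^{\mathbf n}=\{\lambda: d(\lambda)=\mathbf n,\ r(\lambda)=v\}$; $v\Lambda w=\{\lambda: r(\lambda)=v,\ s(\lambda)=w\}$. $\Lambda$ is row-finite if every $v\Lambda^{\mathbf n}$ is finite, and without sources if every $v\Lambda^{\mathbf n}$ is nonempty. A nonempty $M\subseteq\Lambda^0$ is a maximal tail if: (MT1) $w\in M$, $v\in\Lambda^0$, $v\Lambda w\ne\emptyset$ imply $v\in M$; (MT2) for $v\in M$ and $1\le i\le k$ there is $\lambda\in v\Lambda^{\mathbf e_i}$ with $s(\lambda)\in M$; (MT3) for $u,v\in M$ there is $w\in M$ with $u\Lambda w\ne\emptyset$ and $v\Lambda w\neq\emptyset$. $\mathscr M(\Lambda)$ is the set of maximal tails ordered by inclusion. The talented monoid $T_\Lambda$ is the commutative monoid generated by symbols $v(\mathbf n)$ ($v\in\Lambda^0$, $\mathbf n\in\mathbb Z^k$) subject to $v(\mathbf n)=\sum_{\alpha\in v\Lambda^{\mathbf m}}s(\alpha)(\mathbf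 n+\mathbf m)$ for all $v\in\Lambda^0,\mathbf n\in\mathbb Z^k,\mathbf m\in\mathbb N^k$, with $\mathbb Z^k$ acting by ${}^{\mathbf q}v(\mathbf n)=v(\mathbf n+\mathbf q)$; the semiring $\mathbb N[\mathbb Z^k]$ acts by ${}^{(\sum n_i\mathbf q_i)}x=\sum n_i\,{}^{\mathbf q_i}x$. The algebraic preorder is $x\le y$ iff $y=x+z$ for some $z$. A $\mathbb Z^k$-order ideal is a submonoid that is a down-set for $\le$ and closed under $\mathbb Z^k$. For $H\subseteq\Lambda^0$, $J_H$ is the $\mathbb Z^k$-order ideal generated by $\{v(0):v\in H\}$; for a $\mathbb Z^k$-order ideal $J$, $H_J:=\{v\in\Lambda^0: v(0)\in J\}$. A nonempty $\mathcal F\subseteq T_\Lambda$ is a $\mathbb Z^k$-filter if: (F1) $0\notin\mathcal F$ and $\mathcal F$ is closed under $\mathbb Z^k$; (F2) $x\in\mathcal F$, $y\ge x$ imply $y\in\mathcal F$; (F3) for $x,y\in\mathcal F$ there are $\alpha,\beta\in\mathbb N[\mathbb Z^k]$, $z\in\mathcal F$ with ${}^\alpha x\ge z$ and ${}^\beta y\ge z$. It is prime if $x+y\in\mathcal F$ implies $x\in\mathcal F$ or $y\in\mathcal F$. $\mathscr{PF}il(T_\Lambda)$ is the set of prime $\mathbb Z^k$-filters ordered by inclusion. (If $\mathcal F$ is a prime $\mathbb Z^k$-filter then $T_\Lambda\setminus\mathcal F$ is a $\mathbb Z^k$-order ideal.)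
   Formalization: The last equivalence fails for arbitrary M (directed 2-cycle on u,w, M={u}); it is replaced by: M is a maximal tail iff F(M) is a prime filter and M(F(M))=M, and by the stated equivalence for M satisfying (MT1) and (MT2). *)

(* Defs.v *)
From HB Require Import structures.
From mathcomp Require Import all_boot all_order all_algebra finmap multiset.
From mathcomp Require Import generic_quotient.
From mathcomp Require Import boolp classical_sets functions cardinality.

Set Implicit Arguments.
Unset Strict Implicit.
Unset Printing Implicit Defensive.

Import GRing.Theory.
Local Open Scope mset_scope.
Local Open Scope classical_set_scope.
Local Open Scope ring_scope.
Local Open Scope quotient_scope.

(* [N^k] is ['rV[nat]_k], [Z^k] is ['rV[int]_k].  Objects are kept in a separate
   type and identified with the morphisms of degree 0 through [ident].
   [mcomp a b] is the composite a b (apply b first); its value is meaningful only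
   when [src a = rng b], and no axiom constrains it otherwise. *)
Record kgraph (k : nat) := KGraph {
  vtx :> countType;
  mor : countType;
  rng : mor -> vtx;
  src : mor -> vtx;
  ident : vtx -> mor;
  mcomp : mor -> mor -> mor;
  deg : mor -> 'rV[nat]_k;
  rng_ident : forall v, rng (ident v) = v;
  src_ident : forall v, src (ident v) = v;
  rng_mcomp : forall a b, src a = rng b -> rng (mcomp a b) = rng a;
  src_mcomp : forall a b, src a = rng b -> src (mcomp a b) = src b;
  mcomp_identl : forall a, mcomp (ident (rng a)) a = a;
  mcomp_identr : forall a, mcomp a (ident (src a)) = a;
  mcompA : forall a b c, src a = rng b -> src b = rng c ->
    mcomp a (mcomp b c) = mcomp (mcomp a b) c;
  deg_ident : forall v, deg (ident v) = 0;
  deg_mcomp : forall a b, src a = rng b -> deg (mcomp a b) = deg a + deg b;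
  factorization : forall l m n, deg l = m + n ->
    exists! ab : mor * mor,
      [/\ src ab.1 = rng ab.2, deg ab.1 = m, deg ab.2 = n & l = mcomp ab.1 ab.2]
}.

Section KGraph.
Context {k : nat} {L : kgraph k}.
Implicit Types (u v w : L) (M H : set L).

Definition paths v (n : 'rV[nat]_k) : set (mor L) :=
  [set l | deg l = n /\ rng l = v].

Definition connects v w : set (mor L) := [set l | rng l = v /\ src l = w].

Definition MT1 M := forall w v, M w -> connects v w !=set0 -> M v.

Definition MT2 M := forall v (i : 'I_k), M v ->
  exists2 l, paths v (delta_mx 0 i) l & M (src l).

Definition MT3 M := forall u v, M u -> M v ->
  exists w, [/\ M w, connects u w !=set0 & connects v w !=set0].

Definition maximal_tail M := [/\ M !=set0, MT1 M, MT2 M & MT3 M].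

End KGraph.

Definition row_finite (k : nat) (L : kgraph k) :=
  forall (v : L) n, finite_set (paths v n).

Definition no_sources (k : nat) (L : kgraph k) :=
  forall (v : L) n, paths v n !=set0.

(* Finite multisets form the free commutative monoid; in particular
   [{mset 'rV[int]_k}] is the additive monoid of the semiring N[Z^k]. *)
HB.instance Definition _ (K : choiceType) :=
  Choice.copy {mset K} {fsfun K -> nat with 0%N}.
HB.instance Definition _ (K : choiceType) :=
  GRing.isNmodule.Build {mset K}
    (@msetDA K) (@msetDC K) (@mset0D K).

Section TalentedMonoid.
Context {k : nat} (L : kgraph k).

Definition gen : choiceType := (L * 'rV[int]_k)%type.

Definition natv (m : 'rV[nat]_k) : 'rV[int]_k := map_mx Posz m.

(* [fset_set] is empty on infinite sets, so the relation is the intended one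
   only when [paths v m] is finite. *)
Inductive tcong : {mset gen} -> {mset gen} -> Prop :=
| tcong_rel (v : L) (n : 'rV[int]_k) (m : 'rV[nat]_k) :
    tcong [mset (v, n)]
      (\sum_(a <- fset_set (paths v m)) [mset (src a, n + natv m)])
| tcong_refl A : tcong A A
| tcong_sym A B : tcong A B -> tcong B A
| tcong_trans A B C : tcong A B -> tcong B C -> tcong A C
| tcong_add A B A' B' : tcong A B -> tcong A' B' -> tcong (A + A') (B + B').

Definition tcongb (A B : {mset gen}) : bool := `[< tcong A B >].

Fact tcongb_refl : reflexive tcongb.
Proof. by move=> A; apply/asboolP/tcong_refl. Qed.

Fact tcongb_sym : symmetric tcongb.
Proof. by move=> A B; apply/asboolP/asboolP => /tcong_sym. Qed.

Fact tcongb_trans : transitive tcongb.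
Proof.
move=> B A C /asboolP AB /asboolP BC.
by apply/asboolP; apply: tcong_trans AB BC.
Qed.

Canonical tcongb_equiv := EquivRel tcongb tcongb_refl tcongb_sym tcongb_trans.

Definition talented := {eq_quot tcongb}.

HB.instance Definition _ := Choice.on talented.
HB.instance Definition _ := EqQuotient.on talented.

Definition tzero : talented := \pi_talented 0.
Definition tadd (x y : talented) : talented :=
  \pi_talented (repr x + repr y).

Lemma tpiP A B : \pi_talented A = \pi_talented B <-> tcong A B.
Proof.
split=> [H | H]; first exact/asboolP/(@eqquotP _ _ talented).
by apply/(@eqquotP _ _ talented)/asboolP.
Qed.

Lemma repr_tpi A : tcong (repr (\pi_talented A)) A.
Proof. by apply/tpiP; rewrite reprK. Qed.

Lemma tpi_surj (x : talented) : exists A, x = \pi_talented A.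
Proof. by exists (repr x); rewrite reprK. Qed.

Lemma taddE A B :
  tadd (\pi_talented A) (\pi_talented B) = \pi_talented (A + B).
Proof. by apply/tpiP; apply: tcong_add; apply: repr_tpi. Qed.

Fact taddA : associative tadd.
Proof.
move=> x y z; have [A ->] := tpi_surj x; have [B ->] := tpi_surj y.
by have [C ->] := tpi_surj z; rewrite !taddE addrA.
Qed.

Fact taddC : commutative tadd.
Proof. by move=> x y; rewrite /tadd addrC. Qed.

Fact tadd0 : left_id tzero tadd.
Proof. by move=> x; have [A ->] := tpi_surj x; rewrite taddE add0r. Qed.

HB.instance Definition _ := GRing.isNmodule.Build talented taddA taddC tadd0.

Definition tgen (v : L) (n : 'rV[int]_k) : talented :=
  \pi_talented [mset (v, n)].

Definition gshift (q : 'rV[int]_k) (A : {mset gen}) : {mset gen} :=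
  \sum_(g <- A) [mset (g.1, g.2 + q)].

Definition tact (q : 'rV[int]_k) (x : talented) : talented :=
  \pi_talented (gshift q (repr x)).

Lemma gshift0 q : gshift q 0 = 0.
Proof. by rewrite /gshift big_mset0. Qed.

Lemma gshift1 q g : gshift q [mset g] = [mset (g.1, g.2 + q)].
Proof. by rewrite /gshift enum_msetn /= big_seq1. Qed.

Lemma gshiftD q A B : gshift q (A + B) = gshift q A + gshift q B.
Proof.
rewrite /gshift -big_cat; apply: perm_big; apply/allP => x _ /=.
by rewrite count_cat !count_mem_mset msetE2.
Qed.

Lemma gshift_cong q A B : tcong A B -> tcong (gshift q A) (gshift q B).
Proof.
elim=> {A B} [v n m|A|A B _|A B C _ AB _|A B A' B' _ AB _ AB'].
- rewrite gshift1 /= (big_morph _ (gshiftD q) (gshift0 q)).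
  under eq_bigr do rewrite gshift1 /= addrAC.
  exact: tcong_rel.
- exact: tcong_refl.
- exact: tcong_sym.
- exact: tcong_trans.
- by rewrite !gshiftD; apply: tcong_add.
Qed.

Lemma tactE q A : tact q (\pi_talented A) = \pi_talented (gshift q A).
Proof. by apply/tpiP/gshift_cong/repr_tpi. Qed.

Lemma tact_tgen q v n : tact q (tgen v n) = tgen v (n + q).
Proof. by rewrite tactE gshift1. Qed.

Lemma tactD q x y : tact q (x + y) = tact q x + tact q y.
Proof.
have [A ->] := tpi_surj x; have [B ->] := tpi_surj y.
by rewrite [_ + _]taddE !tactE gshiftD [RHS]taddE.
Qed.

(* The action of the element \sum_q (a q) q of N[Z^k]. *)
Definition semiact (a : {mset 'rV[int]_k}) (x : talented) : talented :=
  \sum_(q <- finsupp a) tact q x *+ a q.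

Definition tle (x y : talented) := exists z, y = x + z.

Definition order_ideal (J : set talented) :=
  [/\ J 0, (forall x y, J x -> J y -> J (x + y)),
      (forall x y, tle x y -> J y -> J x) &
      (forall q x, J x -> J (tact q x))].

Definition J_ (H : set L) : set talented :=
  smallest order_ideal [set tgen v 0 | v in H].

Definition H_ (J : set talented) : set L := [set v | J (tgen v 0)].

Definition zfilter (F : set talented) :=
  [/\ F !=set0,
      ~ F 0 /\ (forall q x, F x -> F (tact q x)),
      (forall x y, F x -> tle x y -> F y) &
      (forall x y, F x -> F y -> exists a b z,
         [/\ F z, tle z (semiact a x) & tle z (semiact b y)])].

Definition prime_filter (F : set talented) :=
  zfilter F /\ (forall x y, F (x + y) -> F x \/ F y).

Definition filter_of (M : set L) : set talented :=
  [set x | exists v n, M v /\ tle (tgen v n) x].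

Definition tail_of (F : set talented) : set L := [set v | F (tgen v 0)].

End TalentedMonoid.

Definition order_isomorphism (X Y : Type) (A : set (set X)) (B : set (set Y))
    (f : set X -> set Y) :=
  set_bij A B f /\
  (forall M N, A M -> A N -> (M `<=` N <-> f M `<=` f N)).

Definition inverse_on (X Y : Type) (A : set (set X)) (B : set (set Y))
    (f : set X -> set Y) (g : set Y -> set X) :=
  [/\ set_fun B A g, (forall M, A M -> g (f M) = M) &
      (forall F, B F -> f (g F) = F)].

(* Main.v *)
Require Import Defs.
From mathcomp Require Import all_boot all_order all_algebra.
From mathcomp Require Import finmap multiset generic_quotient.
From mathcomp Require Import boolp classical_sets cardinality.

(** The key is an explicit description of J_H for a hereditary H: the
    generator v(n) lies in J_H iff for some degree m every path in v Lambda^m ends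
    in H.  This condition is compatible with the defining relations of the
    talented monoid, because a path of degree m + n factors uniquely as a path of
    degree m followed by one of degree n.
    Taking for H the complement of a maximal tail M, (MT2) says that no vertex of M
    satisfies it, which gives F(M) = T \ J_(complement of M).
    Taking for H the set of vertices reached from u, it gives (MT3) for M(F): a
    vertex w with w(n) below multiples of both u(0) and v(0) has all of its
    sufficiently long paths ending in vertices reached from both u and v, and by
    primality one of these ends lies in M(F). *)

Set Implicit Arguments.
Unset Strict Implicit.
Unset Printing Implicit Defensive.

Local Open Scope classical_set_scope.

Import GRing.Theory.

(** * Paths and hereditary vertex sets *)

Section Paths.
Local Open Scope ring_scope.
Context {k : nat} {L : kgraph k}.
Implicit Types (u v w : L) (m n : 'rV[nat]_k) (H M : set L).

Lemma paths_cat v m n a b : paths v m a -> paths (src a) n b ->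
  paths v (m + n) (mcomp a b).
Proof.
move=> [da ra] [db rb]; split; first by rewrite deg_mcomp ?da ?db.
by rewrite rng_mcomp ?ra.
Qed.

Lemma paths_split v m n l : paths v (m + n) l ->
  exists a b, [/\ paths v m a, paths (src a) n b & src b = src l].
Proof.
move=> [dl rl]; have [[a b] [[/= sab da db lab] _]] := factorization dl.
exists a, b; split; last by rewrite lab src_mcomp.
  by split=> //; rewrite -rl lab rng_mcomp.
by split.
Qed.

Lemma connects_paths v w : connects v w !=set0 ->
  exists m l, paths v m l /\ src l = w.
Proof. by case=> l [rl sl]; exists (deg l), l. Qed.

Lemma paths_connects v m l : paths v m l -> connects v (src l) !=set0.
Proof. by case=> _ rl; exists l. Qed.

Lemma connects_trans u v w :
  connects u v !=set0 -> connects v w !=set0 -> connects u w !=set0.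
Proof.
move=> [a [ra sa]] [b [rb sb]]; exists (mcomp a b).
by split; rewrite ?rng_mcomp ?src_mcomp ?sa ?rb.
Qed.

Definition hereditary H := forall v w, H v -> connects v w !=set0 -> H w.

Lemma hereditary_connects u : hereditary [set w | connects u w !=set0].
Proof. by move=> v w; exact: connects_trans. Qed.

Lemma MT1_hereditaryC M : MT1 M -> hereditary (~` M).
Proof. by move=> M1 v w nMv vw Mw; apply/nMv/(M1 w). Qed.

(** The degree is a sum of natural multiples of basis vectors; (MT2) supplies each unit step inside
    [M], and the steps are concatenated. *)
Lemma MT2_paths M v n : MT2 M -> M v -> exists2 l, paths v n l & M (src l).
Proof.
move=> M2; rewrite [n]row_sum_delta; move: v.
apply: (big_ind (fun m => forall v, M v -> exists2 l, paths v m l & M (src l)))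
  => [v Mv|m1 m2 IH1 IH2 v Mv|i _].
- by exists (ident v); rewrite ?src_ident//; split; rewrite ?deg_ident ?rng_ident.
- have [a va Ma] := IH1 v Mv; have [b ab Mb] := IH2 _ Ma.
  exists (mcomp a b); first exact: paths_cat.
  by rewrite src_mcomp//; case: ab.
elim: (n _ i) => [|c IH] v Mv.
  exists (ident v); rewrite ?src_ident// scale0r.
  by split; rewrite ?deg_ident ?rng_ident.
have [a va Ma] := M2 v i Mv; have [b ab Mb] := IH _ Ma.
exists (mcomp a b); last by rewrite src_mcomp//; case: ab.
by rewrite -[c.+1]/(1 + c) scalerDl scale1r; exact: paths_cat.
Qed.

(** For hereditary [H] in a row-finite graph without sources, the vertices absorbed at some degree
    form the saturation of [H]. *)
Definition absorbed H m v := forall l, paths v m l -> H (src l).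

(** Once a path has reached [H], its extensions stay there. Hence two absorbing degrees can be
    replaced by their sum. *)
Lemma absorbedDr H m n v :
  hereditary H -> absorbed H m v -> absorbed H (m + n) v.
Proof.
move=> hH Hv l /paths_split[a [b [va ab <-]]].
exact: hH (Hv _ va) (paths_connects ab).
Qed.

Lemma absorbedDl H m n v :
  hereditary H -> absorbed H m v -> absorbed H (n + m) v.
Proof. by rewrite addrC; exact: absorbedDr. Qed.

Lemma absorbedP H m n v :
  absorbed H (m + n) v <-> forall a, paths v m a -> absorbed H n (src a).
Proof.
split=> [Hv a va b ab|Hv l /paths_split[a [b [va ab <-]]]].
  by rewrite -(@src_mcomp _ _ a)//; [exact/Hv/paths_cat|case: ab].
exact: Hv ab.
Qed.

End Paths.

Section Ideals.
Local Open Scope mset_scope.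
Local Open Scope classical_set_scope.
Local Open Scope ring_scope.
Local Open Scope quotient_scope.
Context {k : nat} {L : kgraph k}.
Context (hfin : row_finite L).
Implicit Types (v w : L) (m : 'rV[nat]_k) (n q : 'rV[int]_k).
Implicit Types (H M : set L) (x y z : talented L) (J F : set (talented L)).

(** * Sums of generators and the algebraic preorder *)

Lemma in_sum_mset1 (I K : choiceType) (s : seq I) (f : I -> K) (g : K) :
  g \in (\sum_(i <- s) [mset f i] : {mset K}) <-> exists2 i, i \in s & g = f i.
Proof.
elim: s => [|i s IH]; first by rewrite big_nil in_mset0; split=> [|[]].
rewrite big_cons in_msetD in_mset1; split.
  case/orP=> [/eqP ->|/IH[j js ->]]; first by exists i; rewrite ?mem_head.
  by exists j; rewrite // inE js orbT.
case=> j; rewrite inE => /orP[/eqP -> ->|js gj]; first by rewrite eqxx.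
by apply/orP; right; apply/IH; exists j.
Qed.

Lemma sum_mset1 (K : choiceType) (A : {mset K}) :
  A = (\sum_(g <- A) [mset g]).
Proof.
apply/msetP => a; rewrite -count_mem_mset.
elim: (enum_mset A) => [|g s IH]; first by rewrite big_nil mset0E.
by rewrite big_cons /= [RHS]mset1DE IH eq_sym.
Qed.

Lemma talented_sum x : exists s : seq (gen L), x = (\sum_(g <- s) tgen g.1 g.2).
Proof.
have [A ->] := tpi_surj x; exists (enum_mset A); rewrite {1}(sum_mset1 A).
elim: (enum_mset A) => [|g s IH]; first by rewrite !big_nil.
by rewrite !big_cons -IH -[LHS]taddE; case: g.
Qed.

Lemma tle_refl x : tle x x.
Proof. by exists 0; rewrite addr0. Qed.

Lemma tle_trans y x z : tle x y -> tle y z -> tle x z.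
Proof. by move=> [a ->] [b ->]; exists (a + b); rewrite addrA. Qed.

Lemma tle_tact q x y : tle x y -> tle (tact q x) (tact q y).
Proof. by move=> [z ->]; exists (tact q z); rewrite tactD. Qed.

Lemma tgen_paths v n m : tgen v n =
  (\sum_(a <- fset_set (paths v m)) tgen (src a) (n + natv m)).
Proof.
have -> : tgen v n = \pi_(talented L)
    (\sum_(a <- fset_set (paths v m)) [mset (src a, (n + natv m))]).
  exact/tpiP/tcong_rel.
by apply: (big_morph (\pi_(talented L))) => // A B; rewrite -taddE.
Qed.

Lemma tle_sum (I : eqType) (s : seq I) (f : I -> talented L) i :
  i \in s -> tle (f i) (\sum_(j <- s) f j).
Proof. by move=> si; rewrite (big_rem i)//=; eexists. Qed.

(** A path of degree m from w to v makes w(n + m) a summand in the expansion of v(n). *)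
Lemma tle_connects v w n : connects v w !=set0 ->
  exists m, tle (tgen w (n + natv m)) (tgen v n).
Proof.
move=> /connects_paths[m [l [vl <-]]]; exists m; rewrite (tgen_paths v n m).
apply: (@tle_sum _ _ (fun a => tgen (src a) _)).
by rewrite in_fset_set// inE.
Qed.

Lemma semiact1 q x : semiact [mset q] x = tact q x.
Proof. by rewrite /semiact finsupp_msetn big_seq_fset1 msetnxx. Qed.

(** * Order ideals and the ideal generated by a hereditary set *)

Lemma order_ideal_sum J (I : eqType) (s : seq I) (f : I -> talented L) :
  order_ideal J -> (forall i, i \in s -> J (f i)) -> J (\sum_(i <- s) f i).
Proof.
by move=> [J0 JD _ _] Jf; rewrite big_seq; apply: big_ind.
Qed.

Lemma order_ideal_semiact J (a : {mset 'rV[int]_k}) x :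
  order_ideal J -> J x -> J (semiact a x).
Proof.
move=> oJ Jx; apply: order_ideal_sum => // q _; have [J0 JD _ JT] := oJ.
by elim: (a q) => [//|c IH]; rewrite mulrS; apply: JD => //; exact: JT.
Qed.

Lemma order_ideal_tgen J v n p : order_ideal J -> J (tgen v n) -> J (tgen v p).
Proof.
move=> [_ _ _ JT] /(JT (p - n)).
by rewrite tact_tgen addrC subrK.
Qed.

Lemma order_idealJ H : order_ideal (J_ H).
Proof.
split=> [J [[]]//|x y Jx Jy J JH|x y xy Jy J JH|q x Jx J JH].
- by have [[_ JD _ _] _] := JH; apply: JD; [exact: Jx|exact: Jy].
- by have [[_ _ JL _] _] := JH; apply: JL xy _; exact: Jy.
- by have [[_ _ _ JT] _] := JH; apply: JT; exact: Jx.
Qed.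

Lemma J_tgen H v n : H v -> J_ H (tgen v n).
Proof.
move=> Hv; apply: order_ideal_tgen (order_idealJ H) _.
by apply: sub_gen_smallest; exists v.
Qed.

(** One degree serves all generators; their shifts are ignored, since ideals are invariant under
    translation. *)
Definition absorbed_mset H (A : {mset gen L}) :=
  exists m, forall g, g \in A -> absorbed H m g.1.

Lemma absorbed_mset_paths H v n m : hereditary H ->
  absorbed_mset H [mset (v, n)] <-> absorbed_mset H
    (\sum_(a <- fset_set (paths v m)) [mset (src a, (n + natv m))]).
Proof.
move=> hH; split=> -[p Hp].
  exists p => g /in_sum_mset1[a]; rewrite in_fset_set// inE => va -> /=.
  apply: ((absorbedP H m p v).1 _ a va).
  by apply: absorbedDl => //; apply: (Hp (v, n)); rewrite in_mset1.
(* Degree [m] leads to the terms of the expansion, and [p] absorbs each of them. *)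
exists (m + p) => g; rewrite in_mset1 => /eqP -> /=; apply/absorbedP => a va.
apply: (Hp (src a, _)); apply/in_sum_mset1.
by exists a => //; rewrite in_fset_set// inE.
Qed.

Lemma absorbed_msetD H A B : hereditary H ->
  absorbed_mset H (A + B) <-> absorbed_mset H A /\ absorbed_mset H B.
Proof.
move=> hH; split=> [[m Hm]|[[m Hm] [p Hp]]].
  by split; exists m => g gA; apply: Hm; rewrite in_msetD gA ?orbT.
exists (m + p) => g; rewrite in_msetD => /orP[/Hm|/Hp].
  exact: absorbedDr.
exact: absorbedDl.
Qed.

(** Invariance under the defining relations extends to the congruence, so absorption is well defined
    on the talented monoid. *)
Lemma absorbed_mset_tcong H A B : hereditary H -> tcong A B ->
  absorbed_mset H A <-> absorbed_mset H B.
Proof.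
move=> hH; elim=> {A B} [v n m|//|A B _ ->//|A B C _ -> _ ->//|].
  exact: absorbed_mset_paths.
by move=> A B A' B' _ AB _ AB'; rewrite !absorbed_msetD// AB AB'.
Qed.

(** Absorption of a sum is equivalent to absorption of both summands: one direction gives closure
    under addition, the other the down-set property. *)
Lemma order_ideal_absorbed H : hereditary H ->
  order_ideal [set x : talented L | absorbed_mset H (repr x)].
Proof.
move=> hH.
have absD x y : absorbed_mset H (repr (x + y)) <->
    absorbed_mset H (repr x) /\ absorbed_mset H (repr y).
  by rewrite -absorbed_msetD//; apply: absorbed_mset_tcong => //; exact: repr_tpi.
split=> /=.
- apply/(absorbed_mset_tcong hH (repr_tpi _)).
  by exists 0 => g; rewrite in_mset0.
- by move=> x y Hx Hy; apply/absD.
- by move=> x _ [z ->] /absD[].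
move=> q x [m Hm]; apply/(absorbed_mset_tcong hH (repr_tpi _)).
by exists m => g /in_sum_mset1[h /Hm ? ->].
Qed.

(** The absorbed elements form an ideal containing the generators of [J_ H], hence all of it.
    Conversely, expanding v(n) in degree [m] leaves only generators at vertices of [H]. *)
Lemma J_tgenP H v n : hereditary H ->
  J_ H (tgen v n) <-> exists m, absorbed H m v.
Proof.
move=> hH; split=> [Jv|[m Hm]].
  have : absorbed_mset H (repr (tgen v n)).
    apply: (smallest_sub (order_ideal_absorbed hH) _ Jv) => _ [w Hw <-].
    apply/(absorbed_mset_tcong hH (repr_tpi _)).
    exists 0 => g; rewrite in_mset1 => /eqP -> l /paths_connects.
    exact: hH.
  move=> /(absorbed_mset_tcong hH (repr_tpi _))[m Hm].
  by exists m; apply: (Hm (v, n)); rewrite in_mset1.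
rewrite (tgen_paths v n m); apply: order_ideal_sum (order_idealJ H) _ => a.
by rewrite in_fset_set// inE => va; apply: J_tgen; exact: Hm.
Qed.

(** * Prime filters *)

Lemma filter_tgen F v n p : prime_filter F -> F (tgen v n) -> F (tgen v p).
Proof.
move=> [[_ [_ FT] _ _] _] /(FT (p - n)).
by rewrite tact_tgen addrC subrK.
Qed.

Lemma filter_sum F (I : eqType) (s : seq I) (f : I -> talented L) :
  prime_filter F -> F (\sum_(i <- s) f i) -> exists2 i, i \in s & F (f i).
Proof.
move=> [[_ [F0 _] _ _] FP]; elim: s => [|i s IH]; first by rewrite big_nil => /F0.
rewrite big_cons => /FP[Fi|/IH[j js Fj]]; first by exists i; rewrite ?mem_head.
by exists j; rewrite // inE js orbT.
Qed.

(** Primality selects a summand from a decomposition of [x] into generators. *)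
Lemma filter_le_tgen F x : prime_filter F -> F x ->
  exists v n, F (tgen v n) /\ tle (tgen v n) x.
Proof.
move=> pF; have [s ->] := talented_sum x.
move=> /(filter_sum pF)[[v n] sv Fv]; exists v, n; split=> //.
exact: (@tle_sum _ _ (fun g => tgen g.1 g.2) _ sv).
Qed.

Lemma filter_paths F v m : prime_filter F -> F (tgen v 0) ->
  exists2 l, paths v m l & F (tgen (src l) 0).
Proof.
move=> pF; rewrite (tgen_paths v _ m) => /(filter_sum pF)[l].
by rewrite in_fset_set// inE => vl /(filter_tgen 0 pF); exists l.
Qed.

(** * From maximal tails to prime filters and back *)

Lemma MT_J_tgen M v n : MT1 M -> MT2 M -> J_ (~` M) (tgen v n) <-> ~ M v.
Proof.
move=> M1 M2; split; last by move=> nMv; exact: J_tgen.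
move=> /(J_tgenP _ _ (MT1_hereditaryC M1))[m Hm] Mv.
by have [l /Hm] := MT2_paths m M2 Mv.
Qed.

(** An element above no generator from [M] is a sum of generators at vertices outside [M]. *)
Lemma filter_of_J M : MT1 M -> MT2 M -> filter_of M = ~` J_ (~` M).
Proof.
move=> M1 M2; have oJ := order_idealJ (~` M); have [_ _ JL _] := oJ.
apply/seteqP; split=> [x [v [n [Mv vx]]] Jx|x nJx].
  by have /(MT_J_tgen _ _ M1 M2) := JL _ _ vx Jx.
apply: contrapT => nFx; apply: nJx.
have [s xs] := talented_sum x; rewrite {}xs in nFx *.
apply: order_ideal_sum => // -[v n] sv.
apply/(MT_J_tgen _ _ M1 M2) => Mv; apply: nFx; exists v, n; split=> //.
exact: (@tle_sum _ _ (fun g => tgen g.1 g.2) _ sv).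
Qed.

(** Primality is closure of the complementary ideal under sums; (F3) comes from (MT3). *)
Lemma filter_of_prime M : maximal_tail M -> prime_filter (filter_of M).
Proof.
move=> [[v0 Mv0] M1 M2 M3]; have FJ := filter_of_J M1 M2.
have [J0 JD _ _] := order_idealJ (~` M); split; last first.
  move=> x y; rewrite FJ => nJxy; apply: contrapT.
  by move=> /not_orP[/contrapT Jx /contrapT Jy]; apply: nJxy; exact: JD.
split.
- by exists (tgen v0 0), v0, 0; split; [exact: Mv0|exact: tle_refl].
- split=> [|q x [v [n [Mv vx]]]]; first by rewrite FJ; apply.
  by exists v, (n + q); split; [exact: Mv|]; rewrite -tact_tgen; exact: tle_tact.
- by move=> x y [v [n [Mv vx]]] xy; exists v, n; split=> //; exact: tle_trans xy.
move=> x y [u [n [Mu ux]]] [v [p [Mv vy]]].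
have [w [Mw uw vw]] := M3 u v Mu Mv.
(* Translating back by the accumulated degree gives both elements the same lower bound w(0). *)
have below t t' n' : connects t' w !=set0 -> tle (tgen t' n') t ->
    exists q, tle (tgen w 0) (tact q t).
  move=> /(tle_connects n')[m wt'] t't; exists (- (n' + natv m)).
  have := tle_tact (- (n' + natv m)) (tle_trans wt' t't).
  by rewrite tact_tgen subrr.
have [a wx] := below _ _ _ uw ux; have [b wy] := below _ _ _ vw vy.
exists [mset a], [mset b], (tgen w 0); rewrite !semiact1; split=> //.
by exists w, 0; split; [exact: Mw|exact: tle_refl].
Qed.

Lemma tail_of_filter_of M : MT1 M -> MT2 M -> tail_of (filter_of M) = M.
Proof.
move=> M1 M2; rewrite filter_of_J//; apply/seteqP; split=> v /=.
  by move=> nJv; apply: contrapT => /(MT_J_tgen _ 0 M1 M2).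
by move=> Mv /(MT_J_tgen _ 0 M1 M2).
Qed.

Lemma filter_of_tail_of F : prime_filter F -> filter_of (tail_of F) = F.
Proof.
move=> pF; have [[_ _ FU _] _] := pF.
apply/seteqP; split=> [x [v [n [Fv vx]]]|x Fx].
  exact: FU (filter_tgen n pF Fv) vx.
have [v [n [Fv vx]]] := filter_le_tgen pF Fx.
by exists v, n; split=> //; exact: filter_tgen Fv.
Qed.

Lemma tail_of_maximal F : prime_filter F -> maximal_tail (tail_of F).
Proof.
move=> pF; have [[[x Fx] _ FU FC] _] := pF; split.
- have [v [n [Fv _]]] := filter_le_tgen pF Fx.
  by exists v; exact: filter_tgen Fv.
- move=> w v Fw /(tle_connects 0)[m wv]; apply: FU wv.
  exact: filter_tgen Fw.
- by move=> v i; exact: filter_paths.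
move=> u v Fu Fv; have [a [b [z [Fz zu zv]]]] := FC _ _ Fu Fv.
have [w [n [Fw wz]]] := filter_le_tgen pF Fz.
(* [z], and with it w(n), lies in the ideal generated by the vertices reached from [t]. *)
have reach t c : tle z (semiact c (tgen t 0)) ->
    exists m, absorbed [set w' | connects t w' !=set0] m w.
  move=> zt; apply: (J_tgenP w n (@hereditary_connects _ _ t)).1.
  have oJ := order_idealJ [set w' | connects t w' !=set0].
  have [_ _ JL _] := oJ; apply: JL (tle_trans wz zt) (order_ideal_semiact c oJ _).
  apply: J_tgen.
  by exists (ident t); split; rewrite ?rng_ident ?src_ident.
have [m um] := reach _ _ zu; have [p vp] := reach _ _ zv.
(* In degree [m + p] every path from [w] ends at a vertex reached from both [u] and [v]. *)
have [l wl Fl] := filter_paths (m + p) pF (filter_tgen 0 pF Fw).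
exists (src l); split=> //.
  exact: (absorbedDr (@hereditary_connects _ _ u) um wl).
exact: (absorbedDl (@hereditary_connects _ _ v) vp wl).
Qed.

End Ideals.

Theorem theorem5p4 (k : nat) (hk : (0 < k)%N) (L : kgraph k)
    (hfin : row_finite L) (hsrc : no_sources L) :
  (forall M : set L, maximal_tail M ->
     prime_filter (filter_of M) /\ filter_of M = ~` J_ (~` M)) /\
  (forall F : set (talented L), prime_filter F ->
     maximal_tail (tail_of F) /\ tail_of F = ~` H_ (~` F)) /\
  [/\ order_isomorphism (@maximal_tail k L) (@prime_filter k L) (@filter_of k L),
      inverse_on (@maximal_tail k L) (@prime_filter k L)
        (@filter_of k L) (@tail_of k L),
      (* For an arbitrary M, primality of F(M) alone does not make M a maximal
         tail (F(M) depends only on an upward closure of M); M must also be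
         recovered from F(M), which is automatic under MT1 and MT2. *)
      (forall M : set L, maximal_tail M <->
         prime_filter (filter_of M) /\ tail_of (filter_of M) = M) &
      (forall M : set L, MT1 M -> MT2 M ->
         (maximal_tail M <-> prime_filter (filter_of M)))].
Proof.
have FP := @filter_of_prime _ _ hfin; have TM := @tail_of_maximal _ _ hfin.
have FT := @filter_of_tail_of k L.
have TF (M : set L) : maximal_tail M -> tail_of (filter_of M) = M.
  by case=> _ M1 M2 _; exact: (tail_of_filter_of hfin M1 M2).
split=> [M tM|]; first by split; [exact: FP|case: tM => _ M1 M2 _; exact: filter_of_J].
(* [H_] of the complement of [F] unfolds to the complement of [tail_of F]. *)
split=> [F pF|]; first by split; [exact: TM|rewrite [RHS]setCK].
split.
- split; first split.
  + exact: FP.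
  + by move=> M N /set_mem tM /set_mem tN MN; rewrite -(TF M)// MN TF.
  + by move=> F pF; exists (tail_of F); [exact: TM|exact: FT].
  + move=> M N tM tN; split=> [MN x [v [n [/MN Nv vx]]]|FMN v]; first by exists v, n.
    (* Both tails are recovered from their filters, so inclusion is reflected. *)
    by rewrite -(TF M tM) -(TF N tN); exact: FMN.
- by split.
- by move=> M; split=> [tM|[/TM + TFM]]; [split; [exact: FP|exact: TF]|rewrite TFM].
(* The tail of a prime F(M) is maximal, and (MT1) and (MT2) identify it with [M]. *)
- move=> M M1 M2; split=> [|/TM]; first exact: FP.
  by rewrite (tail_of_filter_of hfin M1 M2).
Qed.
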